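(* Let $n\ge1$ and let $X$ be a discrete random variable with exactly $K$ mass points in $[0,1]$ ($K\ge1$). Let $P_Y$ be the output distribution of the binomial channel with $n$ trials induced by $X$, and let $P_{Y_r}$ be the Beta-binomial reference output. Then for every integer $L$ with $K<L\le \frac{n+2}{2}$, \[ \chi^2(P_Y\,\|\,P_{Y_r})\ge B_n(L):=\frac{L-K}{2L\prod_{j=1}^{2L-2}\frac{n+j}{n-j+1}}. \]
   Context: For an integer $n\ge1$, the binomial channel has input $X\in[0,1]$, output $Y\in\{0,\dots,n\}$ and transition law $P_{Y|X}(y|x)=\binom{n}{y}x^y(1-x)^{n-y}$; the output distribution induced by input $P_X$ is $P_Y(y)=\int\binom{n}{y}x^y(1-x)^{n-y}\,dP_X(x)$. The reference input is $X_r\sim\mathrm{Beta}(1/2,1/2)$ with induced Beta-binomial output $P_{Y_r}(y)=\frac{\Gamma(y+1/2)\Gamma(n-y+1/2)}{\pi\,\Gamma(y+1)\Gamma(n-y+1)}$, $y=0,\dots,n$. $\chi^2(P\|Q)=\sum_y \frac{(P(y)-Q(y))^2}{Q(y)}$. *)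

(* Defs.v *)
From HB Require Import structures.
From mathcomp Require Import all_boot all_order all_algebra.
From mathcomp Require Import all_classical all_reals all_analysis.
Set Implicit Arguments. Unset Strict Implicit. Unset Printing Implicit Defensive.
Import Order.TTheory GRing.Theory Num.Theory.
Local Open Scope ring_scope.

Definition PY {R : realType} (n K : nat) (x w : 'I_K -> R) (y : nat) : R :=
  \sum_(i < K) w i * ('C(n, y))%:R * x i ^+ y * (1 - x i) ^+ (n - y).

(* Gamma(m + 1/2) for a natural m, written in closed form:
   Gamma(m + 1/2) = sqrt(pi) * (2m)! / (4^m * m!). *)
Definition gamma_half {R : realType} (m : nat) : R :=
  Num.sqrt pi * ((2 * m)`!)%:R / (4 ^+ m * (m`!)%:R).

(* Gamma(m + 1) = m! *)
Definition gamma_nat {R : realType} (m : nat) : R := (m`!)%:R.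

(* Beta-binomial reference output (input Beta(1/2,1/2)):
   P_{Y_r}(y) = Gamma(y+1/2) Gamma(n-y+1/2) / (pi Gamma(y+1) Gamma(n-y+1)). *)
Definition PYr {R : realType} (n : nat) (y : nat) : R :=
  gamma_half y * gamma_half (n - y) / (pi * gamma_nat y * gamma_nat (n - y)).

Definition chi2 {R : realType} (n : nat) (P Q : nat -> R) : R :=
  \sum_(y < n.+1) (P y - Q y) ^+ 2 / Q y.

Definition Bn {R : realType} (n K L : nat) : R :=
  (L - K)%:R /
  (2 * L%:R * \prod_(1 <= j < (2 * L - 2).+1) ((n + j)%:R / (n - j + 1)%:R)).

(* Main.v *)
(** The discrete average over the Gauss-Chebyshev nodes integrates polynomials of
degree at most 2n+1 exactly against Beta(1/2,1/2).  Composing the channel (a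
function [g] of the output becomes the polynomial [\sum_y g y * bern n y]) with
its adjoint gives a self-adjoint operator on polynomials which is triangular in
the monomials; hence the orthonormal shifted Chebyshev polynomials [phi_k] are
its eigenvectors, and the eigenvalue [\prod_(i < k) (n - i) / (n + i + 1)] is
read off the leading coefficient.  So a polynomial [h] of degree at most
[2L - 2] with [E h(X) = 0] is the image of some [g] with
[\sum_y PYr y * g y ^ 2 <= E_r h^2 / eig_(2L-2)], and testing chi2 against [g]
bounds it below in terms of [E_r h] and [E_r h^2].

To choose [h], let [v t = (phi_0 t, ..., phi_(L-1) t)] and let [P] be the
orthogonal projection killing all [v (x_i)], so [tr P >= L - K].  The form
[h t = (v t)^T P (v t)] vanishes at the [x_i], satisfies
[0 <= h t <= |v t|^2 <= 2L] at the nodes, and [E_r h = tr P] by orthonormality;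
hence [E_r h^2 <= 2 L * tr P]. *)

Require Import Defs.
From HB Require Import structures.
From mathcomp Require Import all_boot all_order all_algebra.
From mathcomp Require Import all_classical all_reals all_analysis.
From mathcomp Require Import ring lra zify.
Import Order.TTheory GRing.Theory Num.Theory.
Local Open Scope ring_scope.

(** * Shifted Chebyshev polynomials *)

(* [cheb k] is the shifted Chebyshev polynomial T_k(2x - 1). *)
Fixpoint cheb {R : realType} (k : nat) : {poly R} :=
  match k with
  | 0 => 1
  | k1.+1 => match k1 with
             | 0 => 2 *: 'X - 1
             | k2.+1 => 2 *: ((2 *: 'X - 1) * cheb k1) - cheb k2
             end
  end.

Lemma chebSS (R : realType) (k : nat) :
  cheb k.+2 = 2 *: ((2 *: 'X - 1) * cheb k.+1) - cheb k :> {poly R}.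
Proof. by []. Qed.

Definition horner_lin := (hornerD, hornerN, hornerM, hornerZ, hornerX, fun R => @hornerC R 1).

Lemma horner_cheb (R : realType) (t : R) (k : nat) :
  (cheb k).[(1 + cos t) / 2] = cos (k%:R * t).
Proof.
suff: (cheb k).[(1 + cos t) / 2] = cos (k%:R * t) /\
  (cheb k.+1).[(1 + cos t) / 2] = cos (k.+1%:R * t) by case.
elim: k => [|k [IH1 IH2]].
  by rewrite mul0r cos0 mul1r /= !horner_lin; split=> //; field.
split=> //; rewrite chebSS !horner_lin IH1 IH2.
have -> : k%:R * t = k.+1%:R * t - t by rewrite -natr1; ring.
have -> : k.+2%:R * t = k.+1%:R * t + t by rewrite -natr1; ring.
by rewrite cosB cosD; field.
Qed.

Lemma cheb_lead (R : realType) (k : nat) :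
  (size (cheb k : {poly R}) <= k.+1)%N /\ (0 : R) < (cheb k)`_k.
Proof.
suff: [/\ (size (cheb k : {poly R}) <= k.+1)%N, (0 : R) < (cheb k)`_k,
  (size (cheb k.+1 : {poly R}) <= k.+2)%N & (0 : R) < (cheb k.+1)`_k.+1] by case.
elim: k => [|k [s1 c1 s2 c2]].
  split; rewrite /= ?size_poly1 ?coef1 ?ltr01 //=; last first.
    by rewrite coefB coefZ coefX coef1 mulr1 subr0 ltr0n.
  by apply/leq_sizeP => -[|[|j]] // _; rewrite coefB coefZ coefX coef1 mulr0 subr0.
have E j : (cheb k.+2 : {poly R})`_j =
    4 * (if j == 0%N then 0 else (cheb k.+1)`_j.-1)
    - 2 * (cheb k.+1)`_j - (cheb k)`_j.
  by rewrite chebSS mulrBl mul1r -scalerAl !(coefD, coefN, coefZ, coefXM); ring.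
have z1 i : (k < i)%N -> (cheb k : {poly R})`_i = 0.
  by move=> ki; apply: nth_default (leq_trans s1 ki).
have z2 i : (k.+1 < i)%N -> (cheb k.+1 : {poly R})`_i = 0.
  by move=> ki; apply: nth_default (leq_trans s2 ki).
split=> //; last first.
  rewrite E /= (z1 k.+2) ?(z2 k.+2) ?leqnSn //.
  by rewrite mulr0 !subr0 mulr_gt0 // ltr0n.
apply/leq_sizeP => -[//|j] hj; rewrite E /= (z1 j.+1) ?(z2 j.+1) ?(z2 j) //; try lia.
by rewrite !mulr0 !subr0.
Qed.

(** Polynomial form of 2 cos a cos b = cos(a + b) + cos(a - b), obtained from the three-term
    recurrence by induction on the smaller index. *)
Lemma mul_cheb (R : realType) (i j : nat) : (i <= j)%N ->
  2 *: (cheb i * cheb j) = cheb (i + j) + cheb (j - i) :> {poly R}.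
Proof.
elim/ltn_ind: i => -[|[|i]] IH lij.
- by rewrite subn0 mul1r scaler_nat.
- case: j lij {IH} => // j _; rewrite subn1 add1n chebSS /=; ring.
- rewrite chebSS mulrBl -scalerAl -mulrA scalerBr.
  have h1 := IH i.+1 (ltnSn _) (ltnW lij).
  have h2 := IH i (ltnW (ltnSn _)) (ltnW (ltnW lij)).
  rewrite h2 (scalerAr 2 (2 *: 'X - 1)) h1 mulrDr scalerDr.
  have -> : (j - i = (j - i.+2).+2)%N by lia.
  have -> : (j - i.+1 = (j - i.+2).+1)%N by lia.
  have -> : (i.+2 + j = (i + j).+2)%N by lia.
  have -> : (i.+1 + j = (i + j).+1)%N by lia.
  rewrite (chebSS _ (i + j)) (chebSS _ (j - i.+2)).
  move: (2 *: 'X - 1) (cheb _) (cheb _) (cheb _) (cheb _) => a b c d e.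
  rewrite -!mul_polyC; ring.
Qed.

(** * Gauss-Chebyshev quadrature *)

(* Gauss-Chebyshev nodes (1 + cos((2j+1) pi / (2(n+1)))) / 2. *)
Definition node {R : realType} (n j : nat) : R :=
  (1 + cos (j.*2.+1%:R * (pi / n.+1.*2%:R))) / 2.

Definition quad {R : realType} (n : nat) (p : {poly R}) : R :=
  n.+1%:R^-1 * \sum_(j < n.+1) p.[node n j].

Lemma quadD (R : realType) n (p q : {poly R}) : quad n (p + q) = quad n p + quad n q.
Proof.
rewrite /quad !mulr_sumr -big_split; apply: eq_bigr => j _.
by rewrite hornerD mulrDr.
Qed.

Lemma quadZ (R : realType) n c (p : {poly R}) : quad n (c *: p) = c * quad n p.
Proof.
rewrite /quad !mulr_sumr; apply: eq_bigr => j _.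
by rewrite hornerZ mulrCA.
Qed.

Lemma quad_is_linear (R : realType) n : linear_for *%R (@quad R n).
Proof. by move=> c p q; rewrite quadD quadZ. Qed.

HB.instance Definition _ (R : realType) n :=
  GRing.isLinear.Build R {poly R} R _ (@quad R n) (quad_is_linear R n).

Lemma quad1 (R : realType) n : quad n (1 : {poly R}) = 1.
Proof.
rewrite /quad (eq_bigr (fun=> 1)) => [|j _]; last by rewrite hornerE.
by rewrite sumr_const card_ord mulVf // pnatr_eq0.
Qed.

Lemma le_quad (R : realType) n (p q : {poly R}) :
  (forall j : 'I_n.+1, p.[node n j] <= q.[node n j]) -> quad n p <= quad n q.
Proof.
by move=> le_pq; rewrite ler_wpM2l ?invr_ge0 // ler_sum.
Qed.

Lemma sin_natpi (R : realType) k : sin (k%:R * pi) = 0 :> R.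
Proof.
elim: k => [|k IH]; first by rewrite mul0r sin0.
by rewrite -natr1 mulrDl mul1r sinD IH sinpi mulr0 mul0r addr0.
Qed.

Lemma quad_cheb (R : realType) n k : (k < n.+1.*2)%N ->
  quad n (cheb k) = (k == 0)%:R :> R.
Proof.
case: k => [|k] ltk; first by rewrite quad1.
set t : R := k.+1%:R * (pi / n.+1.*2%:R).
(* The bound on [k] puts [t] strictly between 0 and pi, so the sum may be multiplied by [sin t]
   without losing information. *)
have tpos : 0 < sin t.
  apply: sin_gt0_pi; rewrite /t mulrA; apply/andP; split.
    by rewrite divr_gt0 // mulr_gt0 ?ltr0n ?pi_gt0.
  by rewrite ltr_pdivrMr ?ltr0n // mulrC ltr_pM2l ?pi_gt0 // ltr_nat.
rewrite /quad; set s := \sum_(_ < _) _; suff: sin t * s = 0.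
  by move/eqP; rewrite mulf_eq0 (gt_eqF tpos) /= => /eqP ->; rewrite mulr0.
rewrite /s {s}.
(* Multiplying by [sin t] makes the sum of cosines telescope. *)
rewrite mulr_sumr (eq_bigr (fun j : 'I_n.+1 =>
   (sin (j.+1.*2%:R * t) - sin (j.*2%:R * t)) / 2)) => [|j _].
  rewrite -mulr_suml.
  rewrite -(big_mkord xpredT (fun j => sin (j.+1.*2%:R * t) - sin (j.*2%:R * t))).
  rewrite (telescope_sumr (fun j => sin (j.*2%:R * t))) // mul0r sin0 subr0.
  have -> : n.+1.*2%:R * t = k.+1%:R * pi by rewrite /t; field; rewrite pnatr_eq0.
  by rewrite sin_natpi mul0r.
rewrite horner_cheb.
have -> : k.+1%:R * (j.*2.+1%:R * (pi / n.+1.*2%:R)) = j.*2.+1%:R * t by rewrite /t; ring.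
have -> : j.+1.*2%:R * t = j.*2.+1%:R * t + t by rewrite doubleS -natr1; ring.
have -> : j.*2%:R * t = j.*2.+1%:R * t - t by rewrite -natr1; ring.
by rewrite sinD sinB; field.
Qed.

(** Multiplication by X obeys 4 X T_k = T_(k+1) + 2 T_k + T_(k-1), which matches Pascal's rule
    applied twice. For k = 0 it reads 2 X T_0 = T_1 + T_0, matched by the symmetry of the binomial
    row. *)
Lemma quad_Xn_cheb (R : realType) n a k : (a + k < n.+1.*2)%N ->
  quad n ('X^a * cheb k) = 'C(a.*2, a + k)%:R / 4 ^+ a :> R.
Proof.
elim: a k => [|a IH] k ak.
  by rewrite expr0 mul1r quad_cheb // bin0n divr1.
have n4 : (4 : R) ^+ a != 0 by rewrite expf_neq0 // pnatr_eq0.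
case: k ak => [|k] ak.
  have -> : 'X^(a.+1) * cheb 0 = 2^-1 *: ('X^a * cheb 1 + 'X^a * cheb 0) :> {poly R}.
    rewrite -mulrDr /= -addrA addNr addr0 -scalerAr scalerA mulVf ?pnatr_eq0 // scale1r.
    by rewrite mulr1 exprSr.
  rewrite quadZ quadD !IH; try lia.
  have -> : 'C(a.+1.*2, a.+1 + 0) = ('C(a.*2, a + 1) * 2 + 'C(a.*2, a + 0) * 2)%N.
    rewrite !addn0 addn1 doubleS; case: a {IH ak n4} => [//|a].
    rewrite !(binS a.+1.*2.+1) !(binS a.+1.*2).
    have -> : 'C(a.+1.*2, a) = 'C(a.+1.*2, a.+2).
      by rewrite -bin_sub; last lia; congr ('C(_, _)); lia.
    lia.
  by rewrite natrD !natrM exprSr; field.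
have -> : 'X^(a.+1) * cheb k.+1 = 4^-1 *: (2 *: ('X^a * cheb k.+1) +
     'X^a * cheb k.+2 + 'X^a * cheb k) :> {poly R}.
  rewrite chebSS.
  have -> : 2 *: ('X^a * cheb k.+1) + 'X^a * (2 *: ((2 *: 'X - 1) * cheb k.+1) - cheb k) +
    'X^a * cheb k = 4 *: ('X^(a.+1) * cheb k.+1) :> {poly R}.
    by rewrite exprSr -!mul_polyC; move: ('X^a) => u; rewrite !polyC_natr; ring.
  by rewrite scalerA mulVf ?pnatr_eq0 // scale1r.
rewrite quadZ !quadD quadZ !IH; try lia.
have -> : 'C(a.+1.*2, a.+1 + k.+1) =
    ('C(a.*2, a + k.+1) * 2 + 'C(a.*2, a + k.+2) + 'C(a.*2, a + k))%N.
  by rewrite doubleS addSn !binS !addnS !binS; lia.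
by rewrite !natrD !natrM exprSr; field.
Qed.

(** * Moments of Beta(1/2,1/2) and the reference output *)

(* E[X^a (1 - X)^b] for X ~ Beta(1/2,1/2). *)
Definition beta_moment {R : realType} (a b : nat) : R :=
  (a.*2`! * b.*2`!)%:R / (4 ^+ (a + b) * (a`! * b`! * (a + b)`!)%:R).

Lemma fact_neq0 (R : realType) m : m`!%:R != 0 :> R.
Proof. by rewrite pnatr_eq0 -lt0n fact_gt0. Qed.

Lemma beta_momentSl (R : realType) a b :
  beta_moment a.+1 b = beta_moment a b * (a%:R + 2^-1) / (a + b).+1%:R :> R.
Proof.
rewrite /beta_moment addSn doubleS !factS !natrM exprS.
have n4 : (4 : R) ^+ (a + b) != 0 by rewrite expf_neq0 // pnatr_eq0.
move: (4 ^+ (a + b)) n4 => u n4.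
have := @fact_neq0 R a; have := @fact_neq0 R b; have := @fact_neq0 R (a + b).
have := fun m => @pnatr_eq0 R m.+1 => nz f1 f2 f3.
rewrite -[a.*2.+2%:R]natr1 -[a.*2.+1%:R]natr1 -mul2n natrM.
rewrite -[(a+b).+1%:R]natr1 -[a.+1%:R]natr1 natrD.
move: (nz a) (nz (a + b)%N); rewrite -!natr1 natrD => n1 n2.
by field; rewrite n1 n2 n4 f1 f2 f3.
Qed.

Lemma beta_momentC (R : realType) a b : beta_moment a b = beta_moment b a :> R.
Proof. by rewrite /beta_moment addnC (mulnC _`! a`!) (mulnC (a.*2)`!). Qed.

(** Mirrors (1 - X)^(b+1) = (1 - X)^b - X (1 - X)^b, which drives the induction on [b] in
    [quad_beta]. *)
Lemma beta_moment_split (R : realType) a b :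
  beta_moment a b.+1 = beta_moment a b - beta_moment a.+1 b :> R.
Proof.
rewrite (beta_momentC R a b.+1) !beta_momentSl (beta_momentC R b a) (addnC b a).
have := @pnatr_eq0 R (a + b).+1; rewrite -!natr1 natrD => n1.
by field; rewrite n1.
Qed.

Lemma quad_beta (R : realType) n a b : (a + b < n.+1.*2)%N ->
  quad n ('X^a * (1 - 'X) ^+ b) = beta_moment a b :> R.
Proof.
elim: b a => [|b IH] a ab.
  rewrite expr0 (quad_Xn_cheb R n a 0 ab) /beta_moment !addn0 fact0 muln1.
  have : (a <= a.*2)%N by lia.
  move/bin_fact => <-; have -> : (a.*2 - a = a)%N by lia.
  have n4 : (4 : R) ^+ a != 0 by rewrite expf_neq0 // pnatr_eq0.
  rewrite muln1 !natrM; field.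
  by rewrite n4 !fact_neq0.
rewrite beta_moment_split -!IH; try lia.
by rewrite -linearB; congr quad; rewrite !exprSr; ring.
Qed.

(** The transition probability of output [y], as a Bernstein polynomial in the channel input. *)
Definition bern {R : realType} (n y : nat) : {poly R} :=
  'C(n, y)%:R *: ('X^y * (1 - 'X) ^+ (n - y)).

Lemma quad_bern (R : realType) n y : (y <= n)%N -> quad n (bern n y) = PYr n y :> R.
Proof.
move=> yn; rewrite quadZ quad_beta; last lia.
rewrite /PYr /gamma_half /gamma_nat /beta_moment subnKC // -(bin_fact yn) -!mul2n.
have sp : Num.sqrt pi * Num.sqrt pi = pi :> R by rewrite -expr2 sqr_sqrtr // pi_ge0.
have spn0 : Num.sqrt pi != 0 :> R by rewrite sqrtr_eq0 -ltNge pi_gt0.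
have -> : 4 ^+ n = 4 ^+ y * 4 ^+ (n - y) :> R by rewrite -exprD subnKC.
move: (Num.sqrt pi) sp spn0 => s <- s0; rewrite !natrM.
have n4 m : (4 : R) ^+ m != 0 by rewrite expf_neq0 // pnatr_eq0.
have nb : 'C(n, y)%:R != 0 :> R by rewrite pnatr_eq0 -lt0n bin_gt0.
by field; rewrite !n4 !fact_neq0 s0 nb.
Qed.

(** Given Y_r = y, the input X_r is Beta(y + 1/2, n - y + 1/2), and the product is its k-th moment.
    The degree k + n stays within the exactness of the quadrature. *)
Lemma quad_Xn_bern (R : realType) n y k : (y <= n)%N -> (k <= n)%N ->
  quad n ('X^k * bern n y) =
  PYr n y * \prod_(i < k) ((y%:R + i%:R + 2^-1) / (n + i).+1%:R) :> R.
Proof.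
move=> yn kn; rewrite -quad_bern // /bern -scalerAr !quadZ (mulrA 'X^k) -exprD -mulrA.
congr GRing.mul; rewrite !quad_beta; try lia.
elim: k kn => [|k IH] kn; first by rewrite big_ord0 mulr1.
rewrite addSn beta_momentSl IH ?(ltnW kn) // big_ord_recr /=.
have -> : (k + y + (n - y) = n + k)%N by lia.
by rewrite natrD; ring.
Qed.

Lemma PYr_gt0 (R : realType) n y : 0 < PYr n y :> R.
Proof.
have f m : 0 < m`!%:R :> R by rewrite ltr0n fact_gt0.
by rewrite /PYr /gamma_half /gamma_nat !(mulr_gt0, invr_gt0, sqrtr_gt0, pi_gt0, exprn_gt0, f).
Qed.

(** * Orthonormal Chebyshev polynomials *)

(* Orthonormal for Beta(1/2,1/2). *)
Definition cheb_on {R : realType} (k : nat) : {poly R} :=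
  if k is 0 then 1 else Num.sqrt 2 *: cheb k.

Lemma cheb_on_lead (R : realType) (k : nat) :
  (size (cheb_on k : {poly R}) <= k.+1)%N /\ (0 : R) < (cheb_on k)`_k.
Proof.
case: k => [|k] /=; first by rewrite size_poly1 coef1.
have [s c] := @cheb_lead R k.+1; split.
  exact: leq_trans (size_scale_leq _ _) s.
by rewrite coefZ mulr_gt0 // sqrtr_gt0.
Qed.

Lemma quad_cheb_on (R : realType) n i j : (i <= n)%N -> (j <= n)%N ->
  quad n (cheb_on i * cheb_on j) = (i == j)%:R :> R.
Proof.
wlog ij : i j / (i <= j)%N.
  move=> H i_n jn; case/orP: (leq_total i j) => h; first exact: H.
  by rewrite mulrC eq_sym H.
case: i j ij => [|i] [|j] // ij i_n jn.
- by rewrite mulr1 quad1.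
- by rewrite mul1r quadZ quad_cheb ?mulr0 //; lia.
- rewrite -scalerAl -scalerAr scalerA -expr2 sqr_sqrtr // mul_cheb // quadD.
  rewrite !quad_cheb; try lia.
  by rewrite addSn /= add0r subn_eq0 eqn_leq ij.
Qed.

Lemma cheb_on_node (R : realType) n j k :
  (cheb_on k).[node n j] ^+ 2 <= 2 :> R.
Proof.
case: k => [|k]; first by rewrite hornerC expr1n ler1n.
by rewrite /cheb_on hornerZ horner_cheb exprMn sqr_sqrtr // -[leRHS]mulr1 ler_pM2l //.
Qed.

(** * The channel operator, its adjoint and their composition *)

(* [bern_op n g] is the polynomial x |-> E[g(Y) | X = x]; [bern_dual n u] is the
   function y |-> E[u(X_r) | Y_r = y], its adjoint. *)
Definition bern_op {R : realType} (n : nat) (g : nat -> R) : {poly R} :=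
  \sum_(y < n.+1) g y *: bern n y.

Definition bern_dual {R : realType} (n : nat) (u : {poly R}) (y : nat) : R :=
  quad n (u * bern n y) / PYr n y.

(** The Bernstein-Durrmeyer operator for the arcsine weight. *)
Definition durrmeyer {R : realType} (n : nat) (u : {poly R}) : {poly R} :=
  bern_op n (bern_dual n u).

Definition durr_eig {R : realType} (n k : nat) : R :=
  \prod_(i < k) ((n - i)%:R / (n + i).+1%:R).

Lemma bern_op1 (R : realType) n : bern_op n (fun=> 1) = 1 :> {poly R}.
Proof.
rewrite /bern_op; transitivity ((1 - 'X + 'X : {poly R}) ^+ n); last first.
  by rewrite subrK expr1n.
rewrite exprDn; apply: eq_bigr => y _.
by rewrite scale1r /bern scaler_nat mulrC.
Qed.

(** Trades the factor [y] for a differential operator in the input that no longer depends on [y];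
    [rising_bernS] sums this over all outputs. *)
Lemma deriv_bern (R : realType) n y : (y <= n)%N ->
  'X * (1 - 'X) * (bern n y)^`() =
  y%:R *: bern n y - n%:R *: ('X * bern n y) :> {poly R}.
Proof.
move=> yn; rewrite /bern; set b := (n - y)%N.
have -> : n%:R = y%:R + b%:R :> R by rewrite -natrD subnKC.
rewrite derivZ derivM derivXn deriv_exp derivB derivX -polyC1 derivC polyC1 sub0r.
have e1 : 'X * ('X^(y.-1) *+ y) = y%:R *: 'X^y :> {poly R}.
  by case: (y) => [|z]; rewrite ?scale0r ?mulr0 //= scaler_nat mulrnAr -exprS.
have e2 : (1 - 'X) * ((- 1) * (1 - 'X) ^+ b.-1 *+ b) = - b%:R *: (1 - 'X) ^+ b :> {poly R}.
  case: (b) => [|z]; first by rewrite ?oppr0 ?scale0r ?mulr0.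
  by rewrite /= exprS scaleNr scaler_nat mulN1r mulNrn mulrN mulrnAr.
rewrite -scalerAr.
have -> : 'X * (1 - 'X) * ('X^(y.-1) *+ y * (1 - 'X) ^+ b +
    'X^y * (-1 * (1 - 'X) ^+ b.-1 *+ b)) =
  ('X * ('X^(y.-1) *+ y)) * ((1 - 'X) * (1 - 'X) ^+ b) +
   ('X * 'X^y) * ((1 - 'X) * ((- 1) * (1 - 'X) ^+ b.-1 *+ b)) :> {poly R} by ring.
rewrite e1 e2 -!mul_polyC polyCN polyCD; ring.
Qed.

(* The posterior moments E[X_r^k | Y_r = y], pushed through the channel. *)
Definition rising_bern {R : realType} (n k : nat) : {poly R} :=
  bern_op n (fun y => \prod_(i < k) ((y%:R + i%:R + 2^-1) / (n + i).+1%:R)).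

Lemma rising_bernS (R : realType) n k :
  rising_bern n k.+1 = (n + k).+1%:R^-1 *: ((k%:R + 2^-1) *: rising_bern n k +
    n%:R *: ('X * rising_bern n k) + 'X * (1 - 'X) * (rising_bern n k)^`())
    :> {poly R}.
Proof.
rewrite /rising_bern /bern_op (linear_sum (@deriv R)) !mulr_sumr !scaler_sumr -!big_split /= scaler_sumr.
apply: eq_bigr => y _; have yn : (y <= n)%N by rewrite -ltnS.
set c := \prod_(i < k) _.
rewrite big_ord_recr /= -/c derivZ.
move: (bern n y) (deriv_bern R n y yn) => b Db.
rewrite -!scalerAr Db -!mul_polyC.
by rewrite !polyCM !polyCD; ring.
Qed.

(** In [rising_bernS] the top coefficient is multiplied by n through ['X * p] and by -k through the
    -X^2 p' term, and then divided by n + k + 1. *)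
Lemma rising_bern_lead (R : realType) n k :
  (size (rising_bern n k : {poly R}) <= k.+1)%N /\
  ((k <= n)%N -> (rising_bern n k)`_k = durr_eig n k :> R).
Proof.
elim: k => [|k [s IH]].
  have -> : rising_bern n 0 = 1 :> {poly R}.
    rewrite -(bern_op1 R n); by apply: eq_bigr => y _; rewrite big_ord0.
  by rewrite size_poly1 coef1 /durr_eig big_ord0.
set p : {poly R} := rising_bern n k in s IH *.
have z i : (k < i)%N -> p`_i = 0 by move=> ki; apply: nth_default (leq_trans s ki).
have E j : (rising_bern n k.+1 : {poly R})`_j.+1 = (n + k).+1%:R^-1 *
    ((k%:R + 2^-1) * p`_j.+1 + n%:R * p`_j + (p`_j.+1 *+ j.+1 - p`_j *+ j)).
  rewrite rising_bernS -/p mulrBr mulr1 mulrBl coefZ !coefD !coefZ coefN coefXM -mulrA !coefXM /=.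
  by congr (_ * (_ + (_ - _))); rewrite ?coef_deriv //; case: j => [|j] /=; rewrite ?mulr0n ?coef_deriv.
split.
  apply/leq_sizeP => -[//|j] kj; rewrite E !z; try lia.
  by rewrite !mulr0 !mul0rn subr0 !addr0 mulr0.
move=> kn; rewrite E (z k.+1) // IH ?(ltnW kn) // /durr_eig big_ord_recr /= -/(durr_eig n k).
by rewrite natrB ?(ltnW kn) //; move: (_^-1) => v; ring.
Qed.

Lemma durrmeyer_is_linear (R : realType) n : linear (@durrmeyer R n).
Proof.
move=> c u v; rewrite /durrmeyer /bern_op scaler_sumr -big_split /=.
apply: eq_bigr => y _; rewrite /bern_dual (mulrDl (c *: u)) -scalerAl quadD quadZ.
by rewrite mulrDl scalerDl -mulrA -scalerA.
Qed.

HB.instance Definition _ (R : realType) n :=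
  GRing.isLinear.Build R {poly R} {poly R} _ (@durrmeyer R n) (durrmeyer_is_linear R n).

Lemma durrmeyer_Xn (R : realType) n k : (k <= n)%N ->
  durrmeyer n 'X^k = rising_bern n k :> {poly R}.
Proof.
move=> kn; apply: eq_bigr => y _; rewrite /bern_dual quad_Xn_bern //; last by rewrite -ltnS.
by rewrite mulrC mulKf // gt_eqF // PYr_gt0.
Qed.

Lemma durrmeyer_lead (R : realType) n k (p : {poly R}) : (k <= n)%N -> (size p <= k.+1)%N ->
  (size (durrmeyer n p) <= k.+1)%N /\ (durrmeyer n p)`_k = durr_eig n k * p`_k.
Proof.
move=> kn sp.
have -> : durrmeyer n p = \sum_(i < k.+1) p`_i *: rising_bern n i.
  have {1}-> : p = \poly_(i < k.+1) p`_i.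
    by apply/polyP => j; rewrite coef_poly; case: ltnP => // /(leq_trans sp)/(nth_default _).
  rewrite poly_def linear_sum; apply: eq_bigr => i _.
  by rewrite linearZ /= durrmeyer_Xn // (leq_trans _ kn) // -ltnS.
have z i j : (i < j)%N -> (rising_bern n i : {poly R})`_j = 0.
  by move=> ij; apply: nth_default (leq_trans (proj1 (rising_bern_lead R n i)) ij).
split.
  apply/leq_sizeP => j kj; rewrite coef_sum big1 // => i _.
  by rewrite coefZ z ?mulr0 // (leq_trans (ltn_ord i)).
rewrite coef_sum big_ord_recr /= big1 ?add0r => [|i _]; rewrite coefZ.
  by rewrite (proj2 (rising_bern_lead R n k)) // mulrC.
by rewrite z ?mulr0.
Qed.

Lemma quad_bern_op (R : realType) n (g : nat -> R) v :
  quad n (bern_op n g * v) = \sum_(y < n.+1) PYr n y * g y * bern_dual n v y.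
Proof.
rewrite mulr_suml linear_sum; apply: eq_bigr => y _.
rewrite -scalerAl /= quadZ /bern_dual (mulrC v).
by field; rewrite gt_eqF // PYr_gt0.
Qed.

Lemma quad_durrmeyerC (R : realType) n (u v : {poly R}) :
  quad n (durrmeyer n u * v) = quad n (u * durrmeyer n v).
Proof.
rewrite (mulrC u) !quad_bern_op; apply: eq_bigr => y _; ring.
Qed.

(** * Chebyshev expansions and eigenvectors *)

Lemma cheb_on_span (R : realType) k (p : {poly R}) : (size p <= k)%N ->
  exists c : 'I_k -> R, p = \sum_(i < k) c i *: cheb_on i.
Proof.
elim: k p => [|k IH] p sp.
  exists (fun=> 0); rewrite big_ord0; apply/eqP; by rewrite -size_poly_eq0 -leqn0.
have [sc cc] := cheb_on_lead R k.
set a := p`_k / (cheb_on k)`_k.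
have [|c Ec] := IH (p - a *: cheb_on k).
  apply/leq_sizeP => j; rewrite leq_eqVlt coefB coefZ => /orP[/eqP <-|kj].
    by rewrite /a divfK ?subrr // gt_eqF.
  by rewrite (nth_default _ (leq_trans sp kj)) (nth_default _ (leq_trans sc kj)) mulr0 subr0.
exists (fun i => if unlift ord_max i is Some j then c j else a).
rewrite big_ord_recr /= unlift_none -[LHS](subrK (a *: cheb_on k)) Ec; congr (_ + _).
apply: eq_bigr => i _; have -> : widen_ord (leqnSn k) i = lift ord_max i.
  by apply: val_inj; rewrite /= /bump leqNgt ltn_ord.
by rewrite liftK.
Qed.

Lemma quad_cheb_on_sum (R : realType) n m (c : 'I_m -> R) (j : 'I_m) : (m <= n.+1)%N ->
  quad n ((\sum_(i < m) c i *: cheb_on i) * cheb_on j) = c j.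
Proof.
move=> mn; have le_n (i : 'I_m) : (i <= n)%N by have := ltn_ord i; lia.
rewrite mulr_suml linear_sum (bigD1 j) //= -scalerAl quadZ.
rewrite quad_cheb_on ?le_n // eqxx mulr1 big1 ?addr0 // => i ij.
rewrite -scalerAl quadZ quad_cheb_on ?le_n //.
by rewrite -val_eqE in ij; rewrite (negPf ij) mulr0.
Qed.

(** The residual [r] has degree below [k] because the leading coefficients cancel. It is also
    orthogonal to each [cheb_on j] with j < k: self-adjointness moves the operator onto [cheb_on j],
    whose image has degree at most [j]. Hence it vanishes. *)
Lemma durrmeyer_cheb_on (R : realType) n k : (k <= n)%N ->
  durrmeyer n (cheb_on k) = durr_eig n k *: cheb_on k :> {poly R}.
Proof.
move=> kn; apply/eqP; rewrite -subr_eq0; apply/eqP.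
have [sc _] := cheb_on_lead R k.
have [sd cd] := durrmeyer_lead R n k (cheb_on k) kn sc.
set r := _ - _; have sr : (size r <= k)%N.
  apply/leq_sizeP => j; rewrite leq_eqVlt coefB coefZ => /orP[/eqP <-|kj].
    by rewrite cd subrr.
  by rewrite (nth_default _ (leq_trans sd kj)) (nth_default _ (leq_trans sc kj)) mulr0 subr0.
have [c Ec] := cheb_on_span R k r sr; rewrite Ec big1 // => j _.
have kn1 : (k <= n.+1)%N by exact: leqW.
have jn : (j <= n)%N by rewrite (leq_trans _ kn) // ltnW.
rewrite -(quad_cheb_on_sum R n k c j) // -Ec mulrBl linearB /= -scalerAl quadZ.
rewrite quad_cheb_on // gtn_eqF ?ltn_ord // mulr0 subr0 quad_durrmeyerC.
have [sj _] := durrmeyer_lead R n j (cheb_on j) jn (proj1 (cheb_on_lead R j)).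
have [d ->] := cheb_on_span R j.+1 _ sj.
rewrite mulr_sumr linear_sum big1 ?scale0r // => i _.
rewrite -scalerAr /= quadZ quad_cheb_on // ?gtn_eqF ?mulr0 //.
  by rewrite (leq_trans (ltn_ord i)).
by rewrite (leq_trans _ jn) // -ltnS.
Qed.

(** * Orthogonal projections and their quadratic forms *)

Lemma cV_normE (R : realDomainType) L (u : 'cV[R]_L) :
  (u^T *m u) 0 0 = \sum_(i < L) u i 0 ^+ 2.
Proof. by rewrite mxE; apply: eq_bigr => i _; rewrite mxE expr2. Qed.

Lemma cV_norm_ge0 (R : realDomainType) L (u : 'cV[R]_L) : 0 <= (u^T *m u) 0 0.
Proof. by rewrite cV_normE sumr_ge0 // => i _; rewrite sqr_ge0. Qed.

(** Gram-Schmidt without square roots: a new vector with nonzero image [u] under the current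
    projection is killed by subtracting the rank-one projection onto [u], which costs exactly one
    unit of trace. *)
Lemma exists_annihilating_projection (R : realFieldType) L K (v : 'I_K -> 'cV[R]_L) :
  exists P : 'M[R]_L, [/\ P^T = P, P *m P = P, (forall i, P *m v i = 0)
    & L%:R - K%:R <= \tr P].
Proof.
elim: K v => [|K IH] v.
  by exists 1%:M; rewrite trmx1 mul1mx mxtrace1 subr0; split=> //; case.
have [P [Pt PP Pv trP]] := IH (v \o lift ord0).
have Pall (Q : 'M[R]_L) : (forall i, Q *m v (lift ord0 i) = 0) -> Q *m v ord0 = 0 ->
    forall i, Q *m v i = 0.
  by move=> Q1 Q0 i; case: (unliftP ord0 i) => [j|] ->.
set u := P *m v ord0; have [u0|un0] := eqVneq u 0.
  exists P; split=> //; first exact: Pall.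
  by rewrite -natr1; lra.
set c := (u^T *m u) 0 0.
have cE : u^T *m u = c%:M by rewrite [LHS]mx11_scalar.
have c0 : c != 0.
  apply: contra un0; rewrite /c cV_normE psumr_eq0 => [/allP uE|i _]; last exact: sqr_ge0.
  apply/eqP/colP => i; rewrite [RHS]mxE; apply/eqP.
  by have /= := uE i (mem_index_enum i); rewrite sqrf_eq0.
have Pu : P *m u = u by rewrite mulmxA PP.
have utP : u^T *m P = u^T by rewrite -{1}Pt -trmx_mul Pu.
have utv w : u^T *m w = (v ord0)^T *m (P *m w) by rewrite trmx_mul Pt mulmxA.
exists (P - c^-1 *: (u *m u^T)); split.
- by rewrite linearB linearZ /= trmx_mul trmxK Pt.
- set a := c^-1 *: _.
  have Pa : P *m a = a by rewrite -scalemxAr mulmxA Pu.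
  have aP : a *m P = a by rewrite -scalemxAl -mulmxA utP.
  have aa : a *m a = a.
    rewrite {2}/a -scalemxAr mulmxA -scalemxAl -(mulmxA u) cE mul_mx_scalar.
    by rewrite scalerA mulVf // scale1r.
  by rewrite mulmxBl !mulmxBr PP Pa aP aa subrr subr0.
- apply: Pall => [i|].
    by rewrite mulmxBl -scalemxAl -mulmxA utv Pv !mulmx0 scaler0 subrr.
  rewrite mulmxBl -scalemxAl -mulmxA utv -/u.
  have -> : (v ord0)^T *m u = c%:M by rewrite -cE /u utv -/u Pu.
  by rewrite mul_mx_scalar scalerA mulVf // scale1r subrr.
- rewrite linearB linearZ /= mxtrace_mulC cE mxtrace_scalar mulr1n mulVf //.
  by rewrite -natr1; lra.
Qed.

(** The form is |Pu|^2, and its gap to |u|^2 is |(1 - P)u|^2. *)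
Lemma projection_form_bounds (R : realDomainType) L (P : 'M[R]_L) (u : 'cV[R]_L) :
  P^T = P -> P *m P = P -> 0 <= (u^T *m P *m u) 0 0 <= (u^T *m u) 0 0.
Proof.
move=> Pt PP; apply/andP; split.
  have -> : u^T *m P *m u = (P *m u)^T *m (P *m u).
    by rewrite trmx_mul Pt !mulmxA -[in RHS](mulmxA u^T) PP.
  exact: cV_norm_ge0.
rewrite -subr_ge0.
have -> : (u^T *m u) 0 0 - (u^T *m P *m u) 0 0 =
    (((1%:M - P) *m u)^T *m ((1%:M - P) *m u)) 0 0.
  have Qt : (1%:M - P)^T = 1%:M - P by rewrite linearB /= trmx1 Pt.
  have QQ : (1%:M - P) *m (1%:M - P) = 1%:M - P.
    by rewrite mulmxBl !mulmxBr !mul1mx mulmx1 PP subrr subr0.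
  rewrite trmx_mul Qt mulmxA -[in RHS](mulmxA u^T) QQ.
  by rewrite mulmxBr mulmx1 mulmxBl [RHS]mxE [X in _ = _ + X]mxE.
exact: cV_norm_ge0.
Qed.

(** * Lower bounds on chi-square by test functions *)

(** Completing the square termwise; [s] scales the test function and is left free for a later
    optimisation. *)
Lemma chi2_test (R : realType) n (P Q g : nat -> R) s : (forall y, 0 < Q y) ->
  2 * s * (\sum_(y < n.+1) (P y - Q y) * g y) - s ^+ 2 * (\sum_(y < n.+1) Q y * g y ^+ 2)
  <= chi2 n P Q.
Proof.
move=> Q0; rewrite /chi2 !mulr_sumr -sumrB; apply: ler_sum => y _.
rewrite -subr_ge0.
have -> : (P y - Q y) ^+ 2 / Q y - (2 * s * ((P y - Q y) * g y) - s ^+ 2 * (Q y * g y ^+ 2))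
  = (P y - Q y - s * (Q y * g y)) ^+ 2 / Q y by field; rewrite gt_eqF.
by rewrite divr_ge0 ?sqr_ge0 // ltW.
Qed.

Lemma durr_eig_gt0 (R : realType) n k : (k <= n)%N -> 0 < durr_eig n k :> R.
Proof.
move=> kn; apply: prodr_gt0 => i _.
by rewrite divr_gt0 ?ltr0n // subn_gt0 (leq_trans (ltn_ord i)).
Qed.

Lemma durr_eig_le (R : realType) n k m : (k <= m)%N -> (m <= n)%N ->
  durr_eig n m <= durr_eig n k :> R.
Proof.
elim: m => [|m IH]; first by rewrite leqn0 => /eqP ->.
rewrite leq_eqVlt => /orP[/eqP ->//|km] mn.
apply: le_trans (IH km (ltnW mn)); rewrite /durr_eig big_ord_recr /=.
rewrite -[leRHS]mulr1 ler_pM2l ?durr_eig_gt0 1?ltnW //.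
by rewrite ler_pdivrMr ?ltr0n // mul1r ler_nat; lia.
Qed.

Lemma sum_PY (R : realType) n K (x w : 'I_K -> R) (g : nat -> R) :
  \sum_(y < n.+1) PY n x w y * g y = \sum_(i < K) w i * (bern_op n g).[x i].
Proof.
under eq_bigr do rewrite /PY mulr_suml.
rewrite exchange_big /=; apply: eq_bigr => i _.
rewrite /bern_op horner_sum mulr_sumr; apply: eq_bigr => y _.
rewrite /bern !hornerZ hornerM hornerXn horner_exp hornerD hornerN hornerX hornerC; ring.
Qed.

Lemma chi2_ge_poly (R : realType) n K (x w : 'I_K -> R) m (h : {poly R}) s :
  (m <= n)%N -> (size h <= m.+1)%N -> \sum_(i < K) w i * h.[x i] = 0 ->
  2 * s * quad n h - s ^+ 2 * (quad n (h * h) / durr_eig n m) <=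
  chi2 n (PY n x w) (PYr n).
Proof.
move=> mn sh wh; have [c hE] := cheb_on_span R m.+1 h sh.
(* Inverting the operator on its eigenbasis makes [bern_dual n u] a function of the output whose
   conditional mean is [h]. *)
pose u : {poly R} := \sum_(k < m.+1) (c k / durr_eig n k) *: cheb_on k.
have Su : durrmeyer n u = h.
  rewrite linear_sum hE; apply: eq_bigr => k _.
  have kn : (k <= n)%N by rewrite (leq_trans _ mn) // -ltnS.
  by rewrite linearZ /= durrmeyer_cheb_on // scalerA divfK // gt_eqF // durr_eig_gt0.
have qdot (d : 'I_m.+1 -> R) : quad n (h * (\sum_(k < m.+1) d k *: cheb_on k)) =
    \sum_(k < m.+1) c k * d k.
  rewrite mulr_sumr linear_sum; apply: eq_bigr => k _.
  by rewrite -scalerAr /= quadZ hE quad_cheb_on_sum // mulrC.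
(* The test function has mean 0 under [PY], so the difference of means is [- quad n h]; the sign of
   [- s] compensates. *)
have := chi2_test R n (PY n x w) (PYr n) (bern_dual n u) (- s) (PYr_gt0 R n).
apply: le_trans.
have -> : \sum_(y < n.+1) (PY n x w y - PYr n y) * bern_dual n u y = - quad n h.
  under eq_bigr do rewrite mulrBl.
  rewrite sumrB sum_PY -/(durrmeyer n u) Su wh sub0r; congr (- _).
  rewrite -Su -[durrmeyer n u]mulr1 quad_bern_op; apply: eq_bigr => y _.
  have -> : bern_dual n 1 y = 1 :> R.
    by rewrite /bern_dual mul1r quad_bern -1?ltnS // mulfV // gt_eqF // PYr_gt0.
  by rewrite mulr1.
have -> : \sum_(y < n.+1) PYr n y * bern_dual n u y ^+ 2 = quad n (h * u).
  by rewrite -{1}Su quad_bern_op; apply: eq_bigr => y _; rewrite expr2 mulrA.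
rewrite mulrN mulrN mulNr opprK sqrrN lerB // ler_wpM2l ?sqr_ge0 //.
(* By orthonormality both sides are sums of [c k ^+ 2] over eigenvalues, and the eigenvalue at [m]
   is the smallest. *)
rewrite /u qdot {2}hE qdot mulr_suml; apply: ler_sum => k _.
rewrite mulrA; apply: ler_wpM2l; first by rewrite -expr2 sqr_ge0.
have km : (k <= m)%N by rewrite -ltnS.
by rewrite lef_pV2 ?posrE ?durr_eig_gt0 ?durr_eig_le // (leq_trans km).
Qed.

Lemma prod_durr_eig (R : realType) n m : (m <= n)%N ->
  \prod_(1 <= j < m.+1) ((n + j)%:R / (n - j + 1)%:R) = (durr_eig n m)^-1 :> R.
Proof.
move=> mn; rewrite big_add1 /= big_mkord /durr_eig -prodfV; apply: eq_bigr => i _.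
rewrite invf_div addnS; congr (_ / _%:R).
by have := ltn_ord i; lia.
Qed.

Theorem theorem5 (R : realType) (n K L : nat) (x w : 'I_K -> R) :
  (1 <= n)%N -> (1 <= K)%N ->
  injective x ->
  (forall i, 0 <= x i <= 1) ->
  (forall i, 0 < w i) ->
  \sum_(i < K) w i = 1 ->
  (K < L)%N -> (2 * L <= n + 2)%N ->
  Bn n K L <= chi2 n (PY n x w) (PYr n).
Proof.
move=> _ _ _ _ _ _ KL Ln.
pose v t : 'cV[R]_L := \col_i (cheb_on i).[t].
have [P [Pt PP Pv trP]] := exists_annihilating_projection R L K (v \o x).
pose h : {poly R} := \sum_(i < L) \sum_(j < L) P i j *: (cheb_on i * cheb_on j).
have hE t : h.[t] = ((v t)^T *m P *m v t) 0 0.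
  rewrite /h horner_sum -mulmxA mxE; apply: eq_bigr => i _.
  rewrite horner_sum [(P *m _) _ _]mxE mulr_sumr; apply: eq_bigr => j _.
  by rewrite !mxE hornerZ hornerM mulrCA.
have sh : (size h <= (2 * L - 2).+1)%N.
  apply: leq_trans (size_sum _ _ _) _; apply/bigmax_leqP => i _.
  apply: leq_trans (size_sum _ _ _) _; apply/bigmax_leqP => j _.
  apply: leq_trans (size_scale_leq _ _) _; apply: leq_trans (size_polyMleq _ _) _.
  have [si _] := cheb_on_lead R i; have [sj _] := cheb_on_lead R j.
  by have := ltn_ord i; have := ltn_ord j; lia.
have qh : quad n h = \tr P.
  rewrite linear_sum; apply: eq_bigr => i _.
  have ltn_n (k : 'I_L) : (k <= n)%N by have := ltn_ord k; lia.
  rewrite linear_sum (bigD1 i) //= quadZ quad_cheb_on // eqxx mulr1 big1 ?addr0 // => j ji.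
  by rewrite quadZ quad_cheb_on // eq_sym -val_eqE in ji *; rewrite (negPf ji) mulr0.
have hb (j : 'I_n.+1) : 0 <= h.[node n j] <= 2 * L%:R.
  have /andP[h0 h1] := projection_form_bounds R L P (v (node n j)) Pt PP.
  rewrite hE h0 (le_trans h1) // cV_normE.
  apply: (@le_trans _ _ (\sum_(i < L) 2)); last by rewrite sumr_const card_ord mulr_natr.
  by apply: ler_sum => i _; rewrite mxE; exact: cheb_on_node.
have qhh : quad n (h * h) <= 2 * L%:R * \tr P.
  rewrite -qh -quadZ; apply: le_quad => j; rewrite hornerM hornerZ.
  by have /andP[h0 h1] := hb j; rewrite ler_wpM2r.
have wh : \sum_(i < K) w i * h.[x i] = 0.
  by apply: big1 => i _; rewrite hE -mulmxA [P *m _](Pv i) mulmx0 mxE mulr0.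
have mn : (2 * L - 2 <= n)%N by lia.
have e0 := durr_eig_gt0 R n _ mn.
have L0 : 0 < L%:R :> R by rewrite ltr0n; lia.
(* With e the eigenvalue and T = [\tr P], this scale maximises 2 s T - s^2 (2 L T / e), giving e T /
   (2 L). *)
have := chi2_ge_poly R n K x w _ h (durr_eig n (2 * L - 2) / (2 * L%:R)) mn sh wh.
apply: le_trans; rewrite /Bn prod_durr_eig // qh.
set e := durr_eig n _ in e0 *.
apply: (@le_trans _ _ (e / (2 * L%:R) * \tr P)).
  rewrite invfM invrK mulrC [_^-1 * e]mulrC ler_wpM2l ?divr_ge0 ?mulr_ge0 ?(ltW L0) ?(ltW e0) //.
  by rewrite natrB // ltnW.
have : (e / (2 * L%:R)) ^+ 2 * (quad n (h * h) / e) <=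
    (e / (2 * L%:R)) ^+ 2 * (2 * L%:R * \tr P / e).
  by rewrite ler_wpM2l ?sqr_ge0 // ler_wpM2r // invr_ge0 ltW.
have -> : (e / (2 * L%:R)) ^+ 2 * (2 * L%:R * \tr P / e) = e / (2 * L%:R) * \tr P.
  by field; rewrite !gt_eqF.
by move: (_ ^+ 2 * _) => q; lra.
Qed.
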